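(* Let $V:\mathbb{R}^n\to\mathbb{R}$ be continuously differentiable and $\mu$-convex with $\mu>0$, let $x\in\mathbb{R}^n$ and $d\in\mathbb{R}^n$ with $\|d\|=1$ and $\langle\nabla V(x),d\rangle>0$. Put $f(\alpha):=V(x-\alpha d)-V(x)$, and for $\tau>0$ let $\alpha(\tau)$ denote the nonzero solution $\alpha$ of $f(\alpha)/\alpha^2=-1/\tau$. Then $\tau\mapsto f(\alpha(\tau))$ is strictly increasing for $\tau>2/\mu$.
   Context: $\|\cdot\|$ and $\langle\cdot,\cdot\rangle$ are the Euclidean norm and inner product. $V$ is $\mu$-convex if $V(\cdot)-\frac{\mu}{2}\|\cdot\|^2$ is convex. For convex, continuously differentiable $V$ with $\langle\nabla V(x),d\rangle>0$, the equation $f(\alpha)/\alpha^2=-1/\tau$ has exactly one nonzero solution $\alpha(\tau)$ for each $\tau>0$, and it is positive. *)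

(* Defs.v *)
From mathcomp Require Import all_boot all_order all_algebra.
From mathcomp Require Import all_classical all_reals all_analysis.
Import Order.TTheory GRing.Theory Num.Theory.
Import numFieldNormedType.Exports.

Set Implicit Arguments.
Unset Strict Implicit.
Unset Printing Implicit Defensive.

Local Open Scope classical_set_scope.
Local Open Scope ring_scope.

Definition dotv (R : realType) (n : nat) (u v : 'rV[R]_n) : R :=
  \sum_(i < n) u 0 i * v 0 i.

(* The norm [`|u|] provided by the library on row vectors is the sup norm. *)
Definition enorm (R : realType) (n : nat) (u : 'rV[R]_n) : R :=
  Num.sqrt (dotv u u).

Definition grad (R : realType) (n : nat) (V : 'rV[R]_n -> R) (x : 'rV[R]_n) :
    'rV[R]_n :=
  \row_(i < n) 'D_(delta_mx 0 i) V x.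

(* The topology on ['rV[R]_n] is that of the sup norm, i.e. the usual one. *)
Definition cont_differentiable (R : realType) (n : nat) (V : 'rV[R]_n -> R) :
    Prop :=
  (forall x, differentiable V x) /\ continuous (grad V).

Definition mu_convex (R : realType) (n : nat) (mu : R) (V : 'rV[R]_n -> R) :
    Prop :=
  convex_function setT (fun x : 'rV[R]_n => V x - mu / 2 * enorm x ^+ 2).

Definition energy_diff (R : realType) (n : nat) (V : 'rV[R]_n -> R)
    (x d : 'rV[R]_n) (alpha : R) : R :=
  V (x - alpha *: d) - V x.

(* The nonzero solution of f(alpha) / alpha^2 = - 1 / tau; the default value 0
   would only be returned if there were no such solution. *)
Definition step_size (R : realType) (f : R -> R) (tau : R) : R :=
  xget 0 [set alpha | alpha != 0 /\ f alpha / alpha ^+ 2 = - 1 / tau].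

(* Main.v *)
Require Import Defs.
From mathcomp Require Import all_boot all_order all_algebra.
From mathcomp Require Import all_classical all_reals all_analysis.
From mathcomp Require Import ring lra.
Import Order.TTheory GRing.Theory Num.Theory.
Import numFieldNormedType.Exports.
Local Open Scope ring_scope.

(** Along the line, [f] is strongly convex with [f 0 = 0] and negative slope at
    [0].  Strong convexity between [0] and [b] yields, for [0 < a < b],
    [f b >= (b / a) f a + mu / 2 (b - a) b].  The chord slope [f a / a] is
    nondecreasing, so [f a / a ^ 2 = - 1 / tau1] and [f b / b ^ 2 = - 1 / tau2]
    with [tau1 < tau2] force [a < b]; inserting [f a = - a ^ 2 / tau1] then gives
    [f b - f a >= (b - a) (mu b / 2 - a / tau1)], which is positive as soon as
    [tau1 > 2 / mu].  Existence of the solutions follows from the intermediate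
    value theorem, and their positivity from [f >= 0] on the negatives. *)

Lemma dotv_subZ (R : realType) (n : nat) (x d : 'rV[R]_n) (s : R) :
  dotv (x - s *: d) (x - s *: d) =
  dotv x x - 2 * s * dotv x d + s ^+ 2 * dotv d d.
Proof.
rewrite /dotv !mulr_sumr -sumrB -big_split /=; apply: eq_bigr => i _.
by rewrite !mxE; ring.
Qed.

Lemma sqr_enorm (R : realType) (n : nat) (u : 'rV[R]_n) :
  enorm u ^+ 2 = dotv u u.
Proof.
by rewrite sqr_sqrtr// /dotv sumr_ge0// => i _; rewrite -expr2 sqr_ge0.
Qed.

(** The point at parameter [t * a] is the convex combination of [x - a *: d] and [x] with weights
    [t] and [1 - t]. In the quadratic correction the terms in [dotv x d] cancel, and [dotv d d = 1]
    leaves exactly [t * (1 - t) * a ^+ 2]. *)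
Lemma energy_diff_strong_convex (R : realType) (n : nat) (V : 'rV[R]_n -> R)
    (mu : R) (x d : 'rV[R]_n) :
  mu_convex mu V -> enorm d = 1 -> forall t a : R, 0 <= t <= 1 ->
  energy_diff V x d (t * a) <=
    t * energy_diff V x d a - mu / 2 * (t * (1 - t) * a ^+ 2).
Proof.
move=> cV d1 t a t01.
have dd : dotv d d = 1 by rewrite -sqr_enorm d1 expr1n.
have := cV (Itv01 (proj1 (andP t01)) (proj2 (andP t01))) (x - a *: d) x
  (mem_set I) (mem_set I).
rewrite convRE /=.
have -> : conv (Itv01 (proj1 (andP t01)) (proj2 (andP t01)))
    (x - a *: d : convex_lmodType _) x = x - (t * a) *: d.
  rewrite /conv /= /unstable.onem; apply/rowP => i; rewrite !mxE; ring.
rewrite /unstable.onem !sqr_enorm !dotv_subZ dd /energy_diff.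
by set P := dotv x d; set X := dotv x x; nra.
Qed.

(** Expand [d] in the standard basis and use linearity of the differential. *)
Lemma derive_dotv_grad (R : realType) (n : nat) (V : 'rV[R]_n -> R)
    (x d : 'rV[R]_n) :
  differentiable V x -> 'D_d V x = dotv (grad V x) d.
Proof.
move=> dV; rewrite deriveE// {1}(row_sum_delta d) linear_sum /dotv.
by apply: eq_bigr => i _; rewrite linearZ/= -deriveE// mxE mulrC.
Qed.

Lemma energy_diff_near0 (R : realType) (n : nat) (V : 'rV[R]_n -> R)
    (x d : 'rV[R]_n) :
  differentiable V x -> 0 < dotv (grad V x) d ->
  exists2 c : R, 0 < c & exists2 e : R, 0 < e & forall h : R, h != 0 ->
    `|h| < e -> energy_diff V x d h / h < - c.
Proof.
move=> dV g0; set g := dotv _ _ in g0.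
(* The quotient tends to the derivative along [- d], which is [- g]; half of that slope is a bound
   valid on a punctured neighbourhood of 0. *)
exists (g / 2); first by rewrite divr_gt0.
have /cvg_ex[l] := @diff_derivable _ _ _ _ _ (- d) dV.
move=> cl; have := cl; move/(@cvg_lim _ (@norm_hausdorff _ _)) => ll.
have {}ll : l = - g.
  have <- : 'D_(- d) V x = l by exact: ll.
  by rewrite deriveE// linearN/= -deriveE// derive_dotv_grad.
move: cl; rewrite ll => /cvgr_lt/(_ (- (g / 2))).
have gg : - g < - (g / 2) by lra.
move=> /(_ gg)[e /= e0 He]; exists e => // h h0 he.
have := He h; rewrite /ball_ /= sub0r normrN => /(_ he h0).
by rewrite /energy_diff scalerN [- _ + x]addrC [_ / h]mulrC.
Qed.

Lemma continuous_energy_diff (R : realType) (n : nat) (V : 'rV[R]_n -> R)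
    (x d : 'rV[R]_n) :
  (forall y, differentiable V y) -> continuous (energy_diff V x d).
Proof.
move=> dV a; apply: cvgB; last exact: cvg_cst.
apply: (@continuous_comp _ _ _ (fun a : R => x - a *: d) V).
  apply: cvgB; first exact: cvg_cst.
  by apply: cvgZr_tmp; exact: cvg_id.
exact: differentiable_continuous.
Qed.

Section strongly_convex_line.
Variables (R : realType) (f : R -> R) (mu c e : R).
Hypothesis mu_gt0 : 0 < mu.
Hypothesis f_strong : forall t a : R, 0 <= t <= 1 ->
  f (t * a) <= t * f a - mu / 2 * (t * (1 - t) * a ^+ 2).
Hypothesis f_cont : continuous f.
Hypothesis c_gt0 : 0 < c.
Hypothesis e_gt0 : 0 < e.
Hypothesis f_near0 : forall h, h != 0 -> `|h| < e -> f h / h < - c.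

(* [f_strong] with [t = a / b], cleared of denominators *)
Lemma strong_chord a b : 0 < a -> a <= b ->
  b * f a <= a * f b - mu / 2 * (a * (b - a) * b).
Proof.
move=> a0 ab; have b0 : 0 < b by exact: lt_le_trans ab.
have t01 : 0 <= a / b <= 1.
  by rewrite ler_pdivrMr// mul1r ab andbT divr_ge0// ltW.
have := f_strong (a / b) b t01; rewrite divfK ?gt_eqF// => fa.
have /le_trans := ler_wpM2l (ltW b0) fa; apply.
rewrite le_eqVlt; apply/orP; left; apply/eqP.
by field; rewrite gt_eqF.
Qed.

Lemma quotient_eqP tau a : tau != 0 -> a != 0 ->
  f a / a ^+ 2 = - 1 / tau <-> f a = - (a ^+ 2 / tau).
Proof.
move=> tau0 a0; have a20 : a ^+ 2 != 0 by rewrite expf_neq0.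
split=> [h|->]; last by field; rewrite a0 tau0.
by rewrite -[LHS](divfK a20) h; field.
Qed.

(** Shrinking [a] towards 0 by a factor [m] makes [f (m * a)] positive by the slope bound, and
    strong convexity gives [f (m * a) <= m * f a]. *)
Lemma f_neg_ge0 a : a < 0 -> 0 <= f a.
Proof.
(* [m <= 1] makes it a convex weight; the other bound gives [|m * a| <= e / 2 < e]. *)
move=> a0; pose m := Num.min 1 (e / (2 * - a)).
have ea : 0 < e / (2 * - a) by rewrite divr_gt0// mulr_gt0// oppr_gt0.
have m0 : 0 < m by rewrite lt_min ltr01.
have m1 : m <= 1 by rewrite ge_min lexx.
have me : m * (2 * - a) <= e.
  by rewrite -ler_pdivlMr ?mulr_gt0 ?oppr_gt0// ge_min lexx orbT.
have ma0 : m * a < 0 by rewrite pmulr_rlt0.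
have := f_near0 (m * a); rewrite lt_eqF// ltr0_norm// => /(_ isT).
have mae : - (m * a) < e by lra.
rewrite ltr_ndivrMr// => /(_ mae) fma.
have m01 : 0 <= m <= 1 by rewrite ltW.
have := f_strong m a m01.
have : 0 <= mu / 2 * (m * (1 - m) * a ^+ 2).
  apply: mulr_ge0; first by rewrite divr_ge0// ltW.
  by rewrite mulr_ge0 ?sqr_ge0// mulr_ge0 ?subr_ge0// ltW.
have : 0 < - c * (m * a) by rewrite mulNr -mulrN mulr_gt0// oppr_gt0.
move=> h1 h2 h3; rewrite -(pmulr_rge0 _ m0); lra.
Qed.

Lemma solution_gt0 tau a : 0 < tau -> a != 0 ->
  f a / a ^+ 2 = - 1 / tau -> 0 < a.
Proof.
move=> tau0 a0 /(quotient_eqP _ _ (lt0r_neq0 tau0) a0) fa.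
rewrite lt_neqAle eq_sym a0 /= leNgt; apply/negP => /f_neg_ge0.
by rewrite fa oppr_ge0 leNgt divr_gt0// exprn_even_gt0.
Qed.

Lemma solution_exists tau : 0 < tau ->
  exists a, a != 0 /\ f a / a ^+ 2 = - 1 / tau.
Proof.
move=> tau0; have tau_neq0 := lt0r_neq0 tau0.
(* [s < e] gives [f s < - c * s], and [s <= c * tau] turns this into [f s <= - (s ^+ 2 / tau)]. *)
pose s := Num.min (e / 2) (c * tau).
have s0 : 0 < s by rewrite lt_min divr_gt0//= mulr_gt0.
have se : s < e by move: e_gt0; rewrite gt_min => e0; apply/orP; left; lra.
have sc : s / tau <= c by rewrite ler_pdivrMr// ge_min lexx orbT.
have fs : f s < - c * s.
  by rewrite -ltr_pdivrMr// f_near0 ?gt_eqF// gtr0_norm.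
(* With this [b] the quadratic gain in [strong_chord] is [b * (|f s| + s)], which outweighs
   [b * f s] and forces [f b > 0]. *)
pose b := s + 2 / mu * (`|f s| / s + 1).
have fss : 0 <= `|f s| / s by rewrite divr_ge0// ltW.
have sb : s <= b by rewrite lerDl mulr_ge0// ?divr_ge0 ?addr_ge0// ltW.
have b0 : 0 < b by exact: lt_le_trans sb.
have fb : 0 < f b.
  have := strong_chord s b s0 sb.
  have -> : mu / 2 * (s * (b - s) * b) = b * (`|f s| + s).
    by rewrite /b; field; rewrite !gt_eqF.
  have : 0 <= b * (`|f s| + f s).
    by rewrite mulr_ge0 ?(ltW b0)// -lerBlDr sub0r -normrN ler_norm.
  have : 0 < b * s by rewrite mulr_gt0.
  by move=> h1 h2 h3; rewrite -(pmulr_rgt0 _ s0); lra.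
(* Nonzero roots of [F] are the solutions sought; [F] changes sign on [[s, b]], which avoids 0. *)
pose F a := f a + a ^+ 2 / tau.
have Fs : F s <= 0.
  have : s * (s / tau) <= s * c by rewrite ler_pM2l.
  by rewrite /F expr2 -mulrA; lra.
have Fb : 0 <= F b by rewrite addr_ge0 ?(ltW fb)// divr_ge0 ?sqr_ge0 ?ltW.
have Fc : {within `[s, b], continuous F}%classic.
  apply: continuous_subspaceT => a; apply: cvgD; first exact: f_cont.
  by apply: cvgM; [exact: exprn_continuous|exact: cvg_cst].
have F0 : Num.min (F s) (F b) <= 0 <= Num.max (F s) (F b).
  by rewrite ge_min Fs le_max Fb orbT.
have [a] := IVT sb Fc F0; rewrite in_itv/= => /andP[sa _] Fa.
have a0 : a != 0 by rewrite gt_eqF// (lt_le_trans s0).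
exists a; split=> //; apply/(quotient_eqP _ _ tau_neq0 a0).
by move: Fa; rewrite /F => /eqP; rewrite addr_eq0 => /eqP.
Qed.

Lemma step_sizeP tau : 0 < tau ->
  0 < step_size f tau /\
  f (step_size f tau) = - (step_size f tau ^+ 2 / tau).
Proof.
move=> tau0; rewrite /step_size; case: xgetP => [a _ [a0 fa]|none].
  split; first exact: solution_gt0 fa.
  by apply/(quotient_eqP _ _ (lt0r_neq0 tau0) a0).
(* The default value of [xget] is ruled out by existence. *)
by have [a /none] := solution_exists tau tau0.
Qed.

Lemma step_size_lt tau1 tau2 : 0 < tau1 -> tau1 < tau2 ->
  step_size f tau1 < step_size f tau2.
Proof.
move=> tau10 tau12; have tau20 := lt_trans tau10 tau12.
have [a0 fa] := step_sizeP tau1 tau10; have [b0 fb] := step_sizeP tau2 tau20.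
move: (step_size f tau1) (step_size f tau2) a0 b0 fa fb => a b a0 b0 fa fb.
rewrite ltNge; apply/negP => ba.
have := strong_chord b a b0 ba; rewrite fa fb.
have : 0 <= mu / 2 * (b * (a - b) * a).
  by rewrite !mulr_ge0 ?subr_ge0 ?invr_ge0// ltW.
have tauV : tau2^-1 < tau1^-1 by rewrite ltf_pV2.
(* If [b <= a], the chord slopes [- b / tau2] and [- a / tau1] would be in the wrong order. *)
have : b * tau2^-1 < a * tau1^-1.
  by rewrite (le_lt_trans (ler_wpM2r _ ba)) ?ltr_pM2l ?invr_ge0 ?ltW.
have ab0 : 0 < a * b by rewrite mulr_gt0.
rewrite -(ltr_pM2l ab0); lra.
Qed.

Lemma step_energy_lt tau1 tau2 : 2 / mu < tau1 -> tau1 < tau2 ->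
  f (step_size f tau1) < f (step_size f tau2).
Proof.
move=> mutau1 tau12.
have tau10 : 0 < tau1 by rewrite (lt_trans _ mutau1)// divr_gt0.
have tau20 := lt_trans tau10 tau12.
have tauV : tau1^-1 < mu / 2.
  by rewrite -[ltRHS]invrK invf_div ltf_pV2// ?posrE ?divr_gt0.
have ab := step_size_lt tau1 tau2 tau10 tau12.
have [a0 fa] := step_sizeP tau1 tau10; have [b0 _] := step_sizeP tau2 tau20.
move: (step_size f tau1) (step_size f tau2) ab a0 b0 fa => a b ab a0 b0 fa.
have := strong_chord a b a0 (ltW ab); rewrite -(ltr_pM2l a0) fa.
(* The threshold [2 / mu] enters here: [a / tau1 < a * mu / 2 < b * mu / 2]. Scaled by
   [a * (b - a)], this is the margin by which the chord inequality yields [f a < f b]. *)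
have atb : a * tau1^-1 < b * (mu / 2).
  by rewrite (lt_trans (y := a * (mu / 2)))// ?ltr_pM2l ?ltr_pM2r ?divr_gt0.
have aba : 0 < a * (b - a) by rewrite mulr_gt0// subr_gt0.
by rewrite -(ltr_pM2l aba) in atb; lra.
Qed.

End strongly_convex_line.

Theorem lemma5p6 (R : realType) (n : nat) (V : 'rV[R]_n -> R) (mu : R)
    (x d : 'rV[R]_n)
    (mu_gt0 : 0 < mu)
    (V_C1 : cont_differentiable V)
    (V_convex : mu_convex mu V)
    (d_unit : enorm d = 1)
    (descent : 0 < dotv (grad V x) d) :
  let f := energy_diff V x d in
  {in [pred tau | 2 / mu < tau] &,
    {homo (fun tau => f (step_size f tau)) : tau1 tau2 / tau1 < tau2}}.
Proof.
move=> f tau1 tau2; rewrite inE => mutau1 _ tau12.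
have [dV _] := V_C1.
have [c c0 [e e0 near0]] := energy_diff_near0 _ _ _ _ _ (dV x) descent.
apply: (@step_energy_lt _ _ mu c e) => //.
- exact: energy_diff_strong_convex.
- exact: continuous_energy_diff.
Qed.
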